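(* Let $G$ be a plane signed graph in which some faces are marked as deadly, and let $d$ be the number of deadly faces. If $G$ contains an odd face and every odd face of $G$ is deadly, then $\tau(G)\le \nu_{\mathrm{dead}}(G)+2d-2$, where $\nu_{\mathrm{dead}}(G)$ is the maximum number of pairwise vertex-disjoint odd cycles of $G$ that are vertex-disjoint from (the boundaries of) all deadly faces.
   Context: A signed graph is a simple graph in which every edge is assigned a parity, odd or even. A cycle is odd if it contains an odd number of odd edges. A face of a plane signed graph is odd if its boundary contains an odd number of odd edges, where bridges on the boundary are counted twice; it is even otherwise. A set $S$ of vertices is a transversal if $G\setminus S$ has no odd cycle; $\tau(G)$ is the minimum size of a transversal. A cycle is vertex-disjoint from a face if it shares no vertex with the boundary of that face. *)

(* Defs.v *)
From mathcomp Require Import all_boot all_fingroup.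
From mathcomp Require Import boolp.

Set Implicit Arguments.
Unset Strict Implicit.
Unset Printing Implicit Defensive.

Record signed_graph (V : finType) := SignedGraph {
  edges : {set {set V}};
  odd_edges : {set {set V}};
  edges_card2 : forall A, A \in edges -> #|A| = 2;
  odd_edges_sub : odd_edges \subset edges
}.

Section SignedGraph.
Variables (V : finType) (G : signed_graph V).

Definition adj : rel V := [rel u v | [set u; v] \in edges G].

(* [bridge A] is meant for [A \in edges G]: deleting A separates its ends. *)
Definition adj_del (A : {set V}) : rel V :=
  [rel u v | adj u v && ([set u; v] != A)].

Definition bridge (A : {set V}) : bool :=
  [forall u in A, forall v in A, connect (adj_del A) u v ==> (u == v)].

Definition isolated (v : V) : bool := [forall w, ~~ adj v w].

(* A cycle is the cyclic sequence of its pairwise distinct vertices; its edges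
   are the sets [set x; next c x] for x \in c. *)
Definition is_cycle (c : seq V) : bool := (2 < size c) && ucycleb adj c.

Definition odd_cycle (c : seq V) : bool :=
  is_cycle c && odd (count [pred x | [set x; next c x] \in odd_edges G] c).

(* The cycles of G \ S are the cycles of G that contain no vertex of S. *)
Definition odd_transversal (S : {set V}) : Prop :=
  ~ exists c, odd_cycle c && [disjoint c & S].

Definition tau : nat :=
  #|[arg min_(S < [set: V] | `[< odd_transversal S >]) #|S|]|.

End SignedGraph.

(* Plane graphs, possibly disconnected, are represented combinatorially, up to
   homeomorphism of the sphere (which face is the unbounded one is not
   recorded).
   - [rotation u] lists the neighbours of u in the cyclic order in which the
     edges leave u; its values outside the neighbourhood of u are irrelevant.
   - [face u v] is the face on a fixed side of the edge uv traversed from u to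
     v; it is relevant only when u and v are adjacent. Walking along a face,
     one leaves v by the edge that follows vu around v, whence [faceP]. The
     boundary of a face may consist of several such closed walks, coming from
     different connected components.
   - [iface v] is the face containing v in its boundary when v is isolated;
     otherwise it is irrelevant. *)
Record embedding (V : finType) (G : signed_graph V) (F : finType) := Embedding {
  rotation : V -> {perm V};
  face : V -> V -> F;
  iface : V -> F;
  rotationP : forall u v,
    adj G u v -> porbit (rotation u) v = [set w | adj G u w];
  faceP : forall u v, adj G u v -> face v (rotation v u) = face u v
}.

Section Embedding.
Variables (V : finType) (G : signed_graph V) (F : finType) (M : embedding G F).

Definition boundary (f : F) : {set V} :=
  [set u | [exists v, adj G u v && (face M u v == f)]
           || isolated G u && (iface M u == f)].

Definition boundary_edges (f : F) : {set {set V}} :=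
  [set A in edges G |
    [exists u, exists v, (A == [set u; v]) && (face M u v == f)]].

(* The surface is a sphere: it is connected, and Euler's formula
   |V| - |E| + |F| = 1 + (number of components of G) holds.
   Write B for the number of closed boundary walks, an isolated vertex counting
   as one walk, and C for the number of components. The rotation system of a
   component of genus g satisfies V - E + B = 2 - 2g. By connectedness, the
   multigraph whose nodes are components and faces, with one edge per boundary
   walk, is connected, so B >= C + |F| - 1. Euler's formula is thus equivalent
   to the conjunction of: every component has genus 0, and this multigraph is
   a tree. This says exactly that the components are drawn in the sphere, each
   one inside a single face of every other one. *)
Definition plane : Prop :=
  (forall f g : F,
     connect [rel f1 f2 | ~~ [disjoint boundary f1 & boundary f2]] f g) /\
  #|V| + #|F| = #|edges G| + n_comp (adj G) predT + 1.

Definition odd_face (f : F) : bool :=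
  odd (\sum_(A in boundary_edges f :&: odd_edges G)
         (if bridge G A then 2 else 1)).

Variable dead : {set F}.

Definition dead_free (c : seq V) : Prop :=
  forall f, f \in dead -> [disjoint c & boundary f].

Definition dead_packing (k : nat) (c : 'I_k -> seq V) : Prop :=
  (forall i, odd_cycle G (c i) /\ dead_free (c i)) /\
  (forall i j, i != j -> [disjoint c i & c j]).

(* Disjoint cycles being nonempty, a packing has at most #|V| members. *)
Definition nu_dead : nat :=
  \max_(k < #|V|.+1 | `[< exists c : 'I_k -> seq V, dead_packing c >]) k.

End Embedding.

(* Main.v *)
Require Import Defs.
From mathcomp Require Import all_boot all_fingroup.
From mathcomp Require Import boolp zify.

Set Implicit Arguments.
Unset Strict Implicit.
Unset Printing Implicit Defensive.

(* Let R be the bipartite graph joining each vertex of G to the faces it bounds,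
   and let T be the set of odd faces.  Since G is plane, every cycle of G is the
   set of edges separating some set X of faces from its complement, and it is odd
   iff X contains an odd number of odd faces.  Hence the vertices of G used by a
   T-join of R form a transversal.  Conversely, if U is a set of vertices of G and
   R - U has a union of components containing an odd number of odd faces, then U
   contains an odd cycle.

   It remains to bound a T-join by a packing of such sets U, in any connected
   bipartite graph.  Fix a root x0 in T, and let b minimise the size of a smallest
   join J_b for T + {x0} + {b}.  Contracting the star of b lowers the size of a
   smallest T-join by at most one, and not at all when b = x0.  When b lies on the
   side of the vertices of G and touches no deadly face, {b} joins the packing,
   the other sets coming from the contracted graph; otherwise, the step is paid
   for by a potential whose initial value is 4 per deadly face other than x0. *)

(** * Sums modulo 2 *)

Lemma big_addb_eq1 (N : finType) (x : N) (P : pred N) :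
  \big[addb/false]_(z | P z) (z == x) = P x.
Proof.
rewrite big_mkcond (bigD1 x) //= eqxx big1 => [|z /negPf ->]; last by case: ifP.
by case: (P x).
Qed.

Lemma big_addb_eq1_seq (N : eqType) (s : seq N) (z : N) :
  uniq s -> \big[addb/false]_(x <- s) (z == x) = (z \in s).
Proof.
elim: s => [|x s IH] /=; first by rewrite big_nil.
case/andP=> xs us; rewrite big_cons IH // inE.
by case: eqP => [->|] //=; rewrite (negPf xs).
Qed.

Lemma big_addb_odd (N : finType) (P Q : pred N) :
  \big[addb/false]_(x | P x) Q x = odd #|[pred x | P x && Q x]|.
Proof.
rewrite -sum1_card (big_morph odd oddD (erefl _)) [RHS]big_mkcondr.
by apply: eq_bigr => x _; case: (Q x).
Qed.

(** * Chains modulo 2 and T-joins *)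

Section Chains.
Variables (E N : finType) (I : E -> N -> bool).
Implicit Types (A B J L : {set E}) (x y z : N) (e : E).

Definition symd A B : {set E} := [set e | (e \in A) (+) (e \in B)].

(** The degree parity of x in J, that is, the boundary of J as a chain modulo 2; J is a T-join when
    [bd J] equals T. *)
Definition bd J x : bool := \big[addb/false]_(e in J) I e x.

Definition joins e x y : bool := [forall z, I e z == (z == x) (+) (z == y)].

Definition link L : rel N := [rel x y | [exists e in L, joins e x y]].

Lemma in_symd A B e : (e \in symd A B) = (e \in A) (+) (e \in B).
Proof. by rewrite inE. Qed.

Lemma joinsP e x y : reflect (forall z, I e z = (z == x) (+) (z == y)) (joins e x y).
Proof. by apply: (iffP forallP) => h z; apply/eqP/h. Qed.

Lemma joinsC e x y : joins e x y = joins e y x.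
Proof. by apply: eq_forallb => z; rewrite addbC. Qed.

Lemma link_sym L : symmetric (link L).
Proof. by move=> x y; apply: eq_existsb => e; rewrite joinsC. Qed.

Lemma link_csym L : connect_sym (link L).
Proof. exact: sym_connect_sym (link_sym L). Qed.

Lemma bd_symd A B x : bd (symd A B) x = bd A x (+) bd B x.
Proof.
rewrite /bd big_mkcond [X in _ = X (+) _]big_mkcond [X in _ = _ (+) X]big_mkcond.
rewrite -big_split; apply: eq_bigr => e _; rewrite in_symd /=.
by case: (e \in A); case: (e \in B) => //=; case: (I e x).
Qed.

Lemma bd0 x : bd set0 x = false.
Proof. by rewrite /bd big_set0. Qed.

Lemma bd1 e x : bd [set e] x = I e x.
Proof. by rewrite /bd big_set1. Qed.

Lemma symd_sub A B L : A \subset L -> B \subset L -> symd A B \subset L.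
Proof.
move=> /subsetP sA /subsetP sB; apply/subsetP => e; rewrite in_symd.
by have := sA e; have := sB e; case: (e \in A) => [_ ->|/= h _ /h].
Qed.

Lemma card_symd A B : #|symd A B| + 2 * #|A :&: B| = #|A| + #|B|.
Proof.
have -> : symd A B = (A :\: B) :|: (B :\: A).
  by apply/setP => e; rewrite !inE; case: (e \in A); case: (e \in B).
rewrite cardsU (_ : (A :\: B) :&: (B :\: A) = set0); last first.
  by apply/setP => e; rewrite !inE; case: (e \in A); case: (e \in B).
rewrite cards0 subn0 -(cardsID B A) -(cardsID A B) (setIC B A); lia.
Qed.

Lemma bd_cut J (Y : pred N) :
  \big[addb/false]_(y | Y y) bd J y
    = \big[addb/false]_(e in J) \big[addb/false]_(y | Y y) I e y.
Proof. exact: exchange_big. Qed.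

Lemma joins_cut e x y (Y : pred N) :
  joins e x y -> \big[addb/false]_(z | Y z) I e z = Y x (+) Y y.
Proof.
move=> /joinsP je; under eq_bigr do rewrite je.
by rewrite big_split !big_addb_eq1.
Qed.

Lemma path_chain L x y : connect (link L) x y ->
  exists2 P : {set E}, P \subset L & forall z, bd P z = (z == x) (+) (z == y).
Proof.
move=> /connectP [p]; elim: p x => [|x' p IH] x /=.
  by move=> _ ->; exists set0; rewrite ?sub0set // => z; rewrite bd0 addbb.
case/andP=> /existsP [e /andP [eL /joinsP je]] /IH h /h [P PL bP].
exists (symd [set e] P); first by rewrite symd_sub // sub1set.
move=> z; rewrite bd_symd bd1 je bP.
by case: (z == x); case: (z == x'); case: (z == y).
Qed.

(** Each x in D contributes a path from x to r; the copies of r cancel because D is even. *)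
Lemma join_exists L r (D : N -> bool) :
  (forall x, D x -> connect (link L) x r) -> \big[addb/false]_x D x = false ->
  exists2 Z : {set E}, Z \subset L & forall z, bd Z z = D z.
Proof.
move=> cD pD.
suff [Z ZL bZ] : exists2 Z : {set E}, Z \subset L & forall z,
    bd Z z = \big[addb/false]_(x <- index_enum N) (D x && ((z == x) (+) (z == r))).
  exists Z => // z; rewrite bZ; under eq_bigr do rewrite andb_addr.
  rewrite big_split /= -big_distrl /= pD /= addbF.
  rewrite (bigD1 z) //= eqxx andbT big1 ?addbF // => y.
  by rewrite eq_sym => /negPf ->; rewrite andbF.
elim: (index_enum N) => [|x s [Z ZL bZ]].
  by exists set0; rewrite ?sub0set // => z; rewrite bd0 big_nil.
case Dx: (D x); last by exists Z => // z; rewrite big_cons Dx.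
have [P PL bP] := path_chain (cD _ Dx).
exists (symd P Z); first exact: symd_sub.
by move=> z; rewrite big_cons Dx bd_symd bP bZ.
Qed.

(** Every edge of J has exactly one end in [col], so counting edges amounts to adding degrees on
    that side. *)
Lemma join_parity J (col : pred N) :
  (forall e, e \in J -> exists x y, [/\ col x, ~~ col y & joins e x y]) ->
  odd #|J| = \big[addb/false]_(x | col x) bd J x.
Proof.
move=> h; rewrite bd_cut -sum1_card (big_morph odd oddD (erefl _)).
apply: eq_bigr => e /h [x [y [cx cy je]]].
by rewrite (joins_cut _ je) cx (negPf cy).
Qed.

Definition star x : {set E} := [set e | I e x].

Lemma star_ends L (col : pred N) e b :
  (forall e, e \in L -> exists x y, [/\ col x, ~~ col y & joins e x y]) ->
  e \in L -> I e b -> exists2 y, col y = ~~ col b & joins e b y.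
Proof.
move=> h /h [x [y [cx cy je]]]; have /joinsP jE := je; rewrite jE.
case: eqP => [->|_] /=; first by exists y; rewrite // cx; apply/negbTE.
by move=> /eqP ->; exists x; rewrite ?cx ?(negPf cy) // joinsC.
Qed.

(** * Exchanging joins at the star of a minimising node *)

Section Exchange.
Variables (L : {set E}) (col : pred N) (T0 : N -> bool) (b : N) (B : {set E}).
Hypothesis bicol :
  forall e, e \in L -> exists x y, [/\ col x, ~~ col y & joins e x y].
Hypothesis BL : B \subset L.
Hypothesis bdB : forall z, bd B z = T0 z (+) (z == b).
Hypothesis Bmin : forall J y, J \subset L ->
  (forall z, bd J z = T0 z (+) (z == y)) -> #|B| <= #|J|.

(** Deleting e moves the extra end from b to the other end y of e, and the smaller set obtained
    competes with B in [Bmin]. *)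
Lemma star_swap_lt (J : {set E}) e : J \subset L -> (forall z, bd J z = T0 z (+) (z == b)) ->
  e \in J -> I e b -> #|B| < #|J|.
Proof.
move=> JL bJ eJ eb.
have [y _ /joinsP je] := star_ends bicol (subsetP JL _ eJ) eb.
have -> : #|J| = #|J :\ e|.+1 by rewrite (cardsD1 e) eJ.
apply: (Bmin (y := y)); first by apply: subset_trans JL; rewrite subD1set.
have -> : J :\ e = symd J [set e].
  by apply/setP => f; rewrite !inE; case: eqP => [->|]; rewrite ?eJ //= addbF.
by move=> z; rewrite bd_symd bd1 bJ je; case: (z == b); case: (z == y); case: (T0 z).
Qed.

Lemma star_free e : e \in B -> I e b = false.
Proof. by move=> eB; apply/negP => /(star_swap_lt BL bdB eB); rewrite ltnn. Qed.

Lemma T0b : T0 b.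
Proof.
have := bdB b; rewrite eqxx /bd big1; first by case: (T0 b).
by move=> e /star_free.
Qed.

Lemma even_chain (C : {set E}) : C \subset L -> (forall z, bd C z = false) -> ~~ odd #|C|.
Proof.
move=> CL bC; rewrite (@join_parity C col) ?big1 // => e /(subsetP CL).
exact: bicol.
Qed.

(** The sum D of A and B has boundary x + b and keeps the star edges of A, since B has none. Two
    star edges close up to C when their far ends are connected outside the star. If those of e1 and
    e2 are not, one of the two components misses x, and parity forces a second star edge into it. *)
Lemma cycle_at_star x (A : {set E}) : A \subset L -> (forall z, bd A z = T0 z (+) (z == x)) ->
  1 < #|A :&: star b| ->
  exists C : {set E}, [/\ C \subset symd A B, (forall z, bd C z = false)
    & #|C :&: star b| = 2].
Proof.
move=> AL bA /card_gt1P [e1 [e2 [e1A e2A ne12]]].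
set D := symd A B.
have DL : D \subset L by apply: symd_sub.
have bD z : bd D z = (z == x) (+) (z == b).
  by rewrite bd_symd bA bdB; case: (T0 z); case: (z == x); case: (z == b).
have inD e : e \in A :&: star b -> e \in D /\ I e b.
  rewrite !inE => /andP [eA eb]; rewrite eA; split => //.
  by apply/negP => /star_free; rewrite eb.
pose L1 := D :\: star b.
have build f1 f2 y1 y2 : f1 \in D -> f2 \in D -> f1 != f2 ->
    joins f1 b y1 -> joins f2 b y2 -> I f1 b -> I f2 b ->
    connect (link L1) y1 y2 ->
    exists C : {set E}, [/\ C \subset D, (forall z, bd C z = false)
      & #|C :&: star b| = 2].
  move=> f1D f2D nf j1 j2 i1 i2 /path_chain [P PL bP].
  have PD : P \subset D by apply: subset_trans PL _; apply: subsetDl.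
  have P_star f : f \in P -> I f b = false.
    by move=> /(subsetP PL); rewrite !inE => /andP [/negbTE].
  exists (symd (symd [set f1] [set f2]) P); split.
  - by do !apply: symd_sub; rewrite ?sub1set.
  - move=> z; rewrite !bd_symd !bd1 bP (joinsP _ _ _ j1) (joinsP _ _ _ j2).
    by case: (z == b); case: (z == y1); case: (z == y2).
  - rewrite (_ : _ :&: _ = [set f1; f2]) ?cards2 ?nf //.
    apply/setP => f; rewrite !inE.
    case: eqP => [->|_].
      rewrite i1 (negPf nf) /= andbT; apply/negP => /P_star; by rewrite i1.
    case: eqP => [->|_] /=.
      by rewrite i2 andbT; apply/negP => /P_star; rewrite i2.
    by apply/negP => /andP [/P_star ->].
have [e1D i1] := inD _ e1A; have [e2D i2] := inD _ e2A.
have [y1 c1 j1] := star_ends bicol (subsetP DL _ e1D) i1.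
have [y2 c2 j2] := star_ends bicol (subsetP DL _ e2D) i2.
have [/build h|n12] := boolP (connect (link L1) y1 y2); first exact: (h e1 e2).
(* Outside its star b is isolated, so the component of a far end does not contain b. *)
have b_alone y : connect (link L1) b y -> y = b.
  move=> /connectP [p]; elim: p => [|z p IH] //=.
  case/andP=> /existsP [e /andP [eL1 je]] pz; move: eL1.
  rewrite !inE (joinsP _ _ _ je) eqxx.
  by case: eqP => // bz _; rewrite -bz in pz *; apply: IH.
(* A component of [L1] avoiding x meets the star in an even number of edges. *)
have even_comp f1 w1 : f1 \in D -> I f1 b -> joins f1 b w1 -> col w1 = ~~ col b ->
    ~~ connect (link L1) w1 x ->
    exists f2 w2, [/\ f2 \in D, f1 != f2, I f2 b, joins f2 b w2
      & connect (link L1) w1 w2].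
  move=> f1D if1 jf1 cw1 nwx; pose Y := connect (link L1) w1.
  have nYb : Y b = false.
    apply/negP; rewrite /Y link_csym => /b_alone E1.
    by move: cw1; rewrite E1; case: (col b).
  have : \big[addb/false]_(y | Y y) bd D y = false.
    under eq_bigr do rewrite bD.
    by rewrite big_split !big_addb_eq1 /= nYb addbF; apply/negbTE.
  (* Besides f1, an odd number of edges of D leave the component, and only star edges can leave
     it. *)
  rewrite bd_cut (bigD1 f1) //= (joins_cut _ jf1) nYb /= /Y connect0.
  set r := \big[_/_]_(_ in _ | _) _ => r1; have {r1} : r by move: r1; case: r.
  rewrite /r; apply: contraTP => nex.
  rewrite big1 // => f2 /andP [f2D nf].
  have [u [v [_ _ juv]]] := bicol (subsetP DL _ f2D).
  have [if2|nif2] := boolP (I f2 b).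
    have [w2 _ jf2] := star_ends bicol (subsetP DL _ f2D) if2.
    rewrite (joins_cut _ jf2) [connect _ _ b]nYb /=; apply/negP => cw2.
    by apply: nex; exists f2, w2; split; rewrite // eq_sym.
  rewrite (joins_cut _ juv); have uv : link L1 u v.
    by apply/existsP; exists f2; rewrite in_setD f2D inE nif2.
  by rewrite (same_connect_r (link_csym _) (connect1 uv)) addbb.
have [x1|nx1] := boolP (connect (link L1) y1 x); last first.
  have [f2 [w2 [f2D nf if2 jf2 cw]]] := even_comp _ _ e1D i1 j1 c1 nx1.
  exact: (build e1 f2 y1 w2).
have [x2|nx2] := boolP (connect (link L1) y2 x); last first.
  have [f2 [w2 [f2D nf if2 jf2 cw]]] := even_comp _ _ e2D i2 j2 c2 nx2.
  exact: (build e2 f2 y2 w2).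
by case/negP: n12; apply: connect_trans x1 _; rewrite link_csym.
Qed.

(** A is replaced by A + C. As B + C is a join for T0 + b that meets the star, |B| < |B + C|; since
    |C| is even, C has at least two more edges in A than in B. Hence A + C has at least two edges
    fewer than A, and exactly two star edges fewer, so the part outside the star does not grow. *)
Lemma star_exchange x (A : {set E}) : A \subset L -> (forall z, bd A z = T0 z (+) (z == x)) ->
  1 < #|A :&: star b| ->
  exists A' : {set E}, [/\ A' \subset L, (forall z, bd A' z = T0 z (+) (z == x)),
    #|A' :\: star b| <= #|A :\: star b| & #|A' :&: star b| < #|A :&: star b|].
Proof.
move=> AL bA hA; have [C [CD bC C2]] := cycle_at_star AL bA hA.
have CL : C \subset L by apply: subset_trans CD _; apply: symd_sub.
have BCL : symd B C \subset L by apply: symd_sub.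
have CB : C :&: star b \subset A.
  apply/subsetP => e; rewrite !inE => /andP [/(subsetP CD)]; rewrite in_symd.
  by case eB: (e \in B); rewrite ?addbF // (star_free eB).
have /card_gt0P [e eC] : 0 < #|C :&: star b| by rewrite C2.
have ltBC : #|B| < #|symd B C|.
  apply: (@star_swap_lt _ e) => //.
  - by move=> z; rewrite bd_symd bC addbF.
  - move: eC; rewrite !inE => /andP [->]; rewrite addbT.
    by apply: contraTN => /star_free ->.
  - by move: eC; rewrite !inE => /andP [].
have oC := even_chain CL bC.
have cBC := card_symd B C; have cAC := card_symd A C.
have cC : #|C| = #|A :&: C| + #|B :&: C|.
  rewrite -(cardsID A C) (setIC A); congr (_ + _).
  apply: eq_card => f; rewrite !inE; have := subsetP CD f; rewrite in_symd.
  by case: (f \in C); rewrite ?andbF // => /(_ isT); case: (f \in A); case: (f \in B).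
have sAC : #|symd A C :&: star b| + 2 = #|A :&: star b|.
  have := card_symd (A :&: star b) (C :&: star b).
  rewrite C2 (_ : A :&: star b :&: (C :&: star b) = C :&: star b); last first.
    by apply/setIidPr; rewrite subsetI CB subsetIr.
  rewrite C2 (_ : symd (A :&: star b) (C :&: star b) = symd A C :&: star b); last first.
    by apply/setP => f; rewrite !inE; case: (f \in A); case: (f \in C); case: (I f b).
  lia.
exists (symd A C); split; first exact: symd_sub.
- by move=> z; rewrite bd_symd bC addbF.
- have := cardsID (star b) (symd A C); have := cardsID (star b) A; lia.
- lia.
Qed.

Lemma star_once x (A : {set E}) : A \subset L -> (forall z, bd A z = T0 z (+) (z == x)) ->
  exists A' : {set E}, [/\ A' \subset L, (forall z, bd A' z = T0 z (+) (z == x))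
    & #|A'| <= #|A :\: star b|.+1].
Proof.
move: {2}_.+1 (ltnSn #|A :&: star b|) => n.
elim: n A => // n IH A ltn AL bA.
have [A1|A2] := leqP #|A :&: star b| 1.
  by exists A; split => //; rewrite -(cardsID (star b)); lia.
have [A' [A'L bA' le1 lt2]] := star_exchange AL bA A2.
have [|A'' [h1 h2 h3]] := IH A' _ A'L bA'; first lia.
by exists A''; split => //; lia.
Qed.

End Exchange.
End Chains.

(** * Contracting a star *)

Section Contraction.
Variables (E N : finType) (I : E -> N -> bool) (L : {set E}) (col : pred N) (b : N).
Hypothesis bicol :
  forall e, e \in L -> exists x y, [/\ col x, ~~ col y & joins I e x y].

Definition nbhd : {set N} := [set y | link I L b y].

Definition merge y := if y \in nbhd then b else y.

(** The image of a set of nodes, seen as a chain modulo 2, under [merge]. *)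
Definition push (D : N -> bool) x : bool :=
  \big[addb/false]_(y | merge y == x) D y.

Lemma joins_neq e x y : e \in L -> joins I e x y -> x != y.
Proof.
move=> eL /joinsP je; have [u [v [cu cv /joinsP juv]]] := bicol eL.
apply: contraNneq cv => xy; have := juv u; rewrite je xy addbb eqxx.
by case: eqP => // <-.
Qed.

Lemma nbr_col y : y \in nbhd -> col y = ~~ col b.
Proof.
rewrite inE => /existsP [e /andP [eL je]]; have nby := joins_neq eL je.
have eb : I e b by rewrite (joinsP _ _ _ _ je) eqxx (negPf nby).
have [y' cy' /joinsP je'] := star_ends bicol eL eb.
have := joinsP _ _ _ _ je y; rewrite je' eqxx eq_sym (negPf nby) /=.
by move=> /eqP ->.
Qed.

Lemma nbr_b : b \in nbhd = false.
Proof. by apply/negP => /nbr_col; case: (col b). Qed.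

Lemma merge_b : merge b = b.
Proof. by rewrite /merge nbr_b. Qed.

Lemma merge_nbr y : y \in nbhd -> merge y = b.
Proof. by rewrite /merge => ->. Qed.

Lemma merge_id y : y \notin nbhd -> merge y = y.
Proof. by rewrite /merge => /negPf ->. Qed.

Lemma push_sum (D : N -> bool) (Y : pred N) :
  \big[addb/false]_(x | Y x) push D x = \big[addb/false]_(y | Y (merge y)) D y.
Proof.
rewrite [RHS](partition_big merge Y) //; apply: eq_bigr => x Yx.
by apply: eq_bigl => y; case: eqP => [->|]; rewrite ?Yx ?andbF.
Qed.

Lemma push_addb D D' x : push (fun z => D z (+) D' z) x = push D x (+) push D' x.
Proof. exact: big_split. Qed.

Lemma push_eq1 y x : push (fun z => z == y) x = (x == merge y).
Proof. by rewrite /push big_addb_eq1 eq_sym. Qed.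

Lemma eq_push D D' x : D =1 D' -> push D x = push D' x.
Proof. by move=> h; apply: eq_bigr => y _. Qed.

Lemma push_id D x : x \notin nbhd -> x != b -> push D x = D x.
Proof.
move=> xn xb; rewrite /push (eq_bigl (pred1 x)) ?big_pred1_eq // => y /=.
rewrite /merge; case: ifP => // yn.
by rewrite eq_sym (negPf xb); case: eqP yn xn => // -> ->.
Qed.

Definition cinc e := push (I e).

Lemma bd_cinc J x : bd cinc J x = push (bd I J) x.
Proof. by rewrite /bd exchange_big. Qed.

Lemma joins_cinc e x y : joins I e x y -> joins cinc e (merge x) (merge y).
Proof.
move=> /joinsP je; apply/joinsP => z.
by rewrite /cinc (eq_push _ je) push_addb !push_eq1.
Qed.

(** The error [D1] has zero image under [merge], so it is supported on b and its neighbours and has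
    even size. As the star is connected, star edges correct it. *)
Lemma lift_join (J' : {set E}) (D : N -> bool) :
  J' \subset L :\: star I b -> (forall x, bd cinc J' x = push D x) ->
  exists A : {set E}, [/\ A \subset L, (forall x, bd I A x = D x)
    & A :\: star I b = J'].
Proof.
move=> J'L bJ'; pose D1 x := bd I J' x (+) D x.
have pD1 x : push D1 x = false by rewrite push_addb -bd_cinc bJ' addbb.
have [||Z ZL bZ] := @join_exists _ _ I (L :&: star I b) b D1.
- move=> x D1x; have [xn|xn] := boolP (x \in nbhd).
    apply: connect1; rewrite link_sym; move: xn; rewrite inE.
    move=> /existsP [e /andP [eL je]]; apply/existsP; exists e.
    rewrite in_setI eL je inE (joinsP _ _ _ _ je) eqxx andbT.
    case: eqP je => // <- /joinsP je; have [u [v [cu cv /joinsP juv]]] := bicol eL.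
    have := juv u; rewrite je addbb eqxx.
    by case: eqP cv => // <-; rewrite cu.
  have [->|xb] := eqVneq x b; first exact: connect0.
  by have := pD1 x; rewrite push_id // D1x.
- have := push_sum D1 xpredT; rewrite (eq_bigl xpredT) //= => <-.
  by rewrite big1.
exists (symd J' Z); split.
- apply: symd_sub; first by apply: subset_trans J'L _; apply: subsetDl.
  by apply: subset_trans ZL _; apply: subsetIl.
- by move=> x; rewrite bd_symd bZ addKb.
- apply/setP => e; have := subsetP J'L e; have := subsetP ZL e; rewrite !inE.
  case: (e \in J'); case: (e \in Z); case: (I e b); case: (e \in L) => //= h1 h2;
    by [have := h1 isT | have := h2 isT].
Qed.

(* The contracted star keeps the name [b] of its centre, on the other side. *)
Definition ccol x := if x == b then ~~ col b else col x.

Lemma ccol_merge x : x != b -> ccol (merge x) = col x.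
Proof.
move=> xb; have [xn|xn] := boolP (x \in nbhd).
  by rewrite merge_nbr // /ccol eqxx (nbr_col xn).
by rewrite merge_id // /ccol (negPf xb).
Qed.

Lemma outside_star e x y : e \in L :\: star I b -> joins I e x y -> x != b /\ y != b.
Proof.
rewrite !inE => /andP [eb eL] je; have := joins_neq eL je.
move: eb; rewrite (joinsP _ _ _ _ je).
rewrite (eq_sym b x) (eq_sym b y).
case: (x =P b) => [->|_]; case: (y =P b) => [yb|_] //=; first by rewrite yb eqxx.
Qed.

Lemma connect_contract x y : connect (link I L) x y ->
  connect (link cinc (L :\: star I b)) (merge x) (merge y).
Proof.
move=> /connectP [p]; elim: p x => [|z p IH] x /=; first by move=> _ ->.
case/andP=> /existsP [e /andP [eL je]] /IH h /h; apply: connect_trans.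
have [eb|eb] := boolP (I e b); last first.
  apply: connect1; apply/existsP; exists e; rewrite in_setD eL inE eb /=.
  exact: joins_cinc.
have lxz : link I L x z by apply/existsP; exists e; rewrite eL.
move: eb lxz; rewrite (joinsP _ _ _ _ je).
case: eqP => [<- _ lbz|_ /= /eqP <- lxb].
  by rewrite merge_b merge_nbr // inE.
by rewrite merge_b merge_nbr // inE link_sym.
Qed.

(** A face passes its deadness on to the vertex-side node it becomes. The deadness of a vertex is
    dropped: it only bars the vertex from the first component of a cut, where a face-side node never
    lies. *)
Definition cdead (dead : pred N) x :=
  if x == b then [exists y in nbhd, dead y] || (col b && dead b) else dead x.

End Contraction.

(** * Odd cuts, the potential, and pulling cuts back through a contraction *)

(** For p = (U, Y), the nodes of Y form, up to U, a union of components of the graph without U. In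
    the face-vertex graph, U then contains the vertices of an odd cycle avoiding all deadly faces.
    There, a deadly node on the vertex side arises by contraction and stands for an absorbed deadly
    face. *)
Definition odd_cut (E N : finType) (I : E -> N -> bool) (L : {set E})
    (col T dead : pred N) (p : {set N} * {set N}) : Prop :=
  [/\ forall u, u \in p.1 -> ~~ col u && ~~ dead u,
      forall e x y, e \in L -> joins I e x y -> x \in p.1 -> ~~ dead y,
      forall e x y, e \in L -> joins I e x y -> x \in p.2 -> y \in p.2 :|: p.1
    & \big[addb/false]_(y in p.2) T y].

Definition disjoint_cuts (N : finType) (p q : {set N} * {set N}) : bool :=
  [disjoint p.1 & q.1].

(* [f], [d], [t]: on the face side, deadly, in T.  With these values, contracting a
   star lowers the sum over the nodes other than the root by at least 1, or raises
   it by at most 1 when the centre joins the packing. *)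
Definition pot (f d t : bool) : nat :=
  if f then if d then 4 else 2 * t else t + 2 * d.

Definition potential (N : finType) (col T dead : pred N) x :=
  pot (col x) (dead x) (T x).

(** On either side, [pot] is subadditive when deadness is combined by disjunction and membership in
    T by parity. *)
Lemma pot_sum (N : finType) (P col T dead : pred N) f :
  (forall x, P x -> col x = f) ->
  pot f [exists x in P, dead x] (\big[addb/false]_(x | P x) T x)
    <= \sum_(x | P x) potential col T dead x.
Proof.
move=> cP; rewrite (_ : [exists x in P, dead x] = \big[orb/false]_(x | P x) dead x).
  elim/big_rec3: _ => [|x s d t Px]; first by rewrite /pot; case: f {cP}.
  rewrite /potential (cP _ Px) /pot.
  by case: f {cP}; case: (T x); case: (dead x); case: d; case: t => /=; lia.
by rewrite big_orE; apply: eq_existsb.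
Qed.

Section PullBack.
Variables (E N : finType) (I : E -> N -> bool) (L : {set E}) (col : pred N) (b : N).
Hypothesis bicol :
  forall e, e \in L -> exists x y, [/\ col x, ~~ col y & joins I e x y].
Variables (T dead : pred N).

Local Notation merge := (merge I L b).

Definition pull (p : {set N} * {set N}) : {set N} * {set N} :=
  ([set u | ~~ col u && (merge u \in p.1)], [set y | merge y \in p.2]).

Lemma disjoint_pull p q : disjoint_cuts p q -> disjoint_cuts (pull p) (pull q).
Proof.
rewrite /disjoint_cuts !disjoint_subset => /subsetP h.
by apply/subsetP => u; rewrite !inE => /andP [_ /h]; rewrite inE negb_and => ->; rewrite orbT.
Qed.

Let cI := cinc I L b.
Let cL := L :\: star I b.
Let cT := push I L b T.
Let ccl := ccol col b.
Let cde := cdead I L col b dead.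

(** If the contracted node is in the first component, then b was a face, and the pulled back set
    contains the neighbours of b but not b. The parity of T on the second component is unchanged by
    [push_sum]. *)
Lemma odd_cut_pull p : odd_cut cI cL ccl cT cde p -> odd_cut I L col T dead (pull p).
Proof.
case=> h1 h2 h3 h4.
have nb u : u \in (pull p).1 -> u != b.
  rewrite inE => /andP [cu]; apply: contraTneq => ub.
  rewrite ub (merge_b b bicol); apply/negP => /h1; rewrite /ccl /ccol eqxx negbK -ub.
  by rewrite (negPf cu).
have undead u : ~~ cde (merge u) -> u != b -> ~~ dead u.
  move=> + ub; have [un|un] := boolP (u \in nbhd I L b).
    rewrite merge_nbr // /cde /cdead eqxx negb_or => /andP [+ _].
    by apply: contraNN => du; apply/existsP; exists u; rewrite un.
  by rewrite merge_id // /cde /cdead (negPf ub).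
split.
- move=> u uU; have ub := nb _ uU; move: uU; rewrite inE => /andP [cu /h1 /andP [_ du]].
  by rewrite cu undead.
- move=> e x y eL je xU; have xb := nb _ xU; move: xU; rewrite inE => /andP [cx xU].
  have [eb|eb] := boolP (I e b).
    move: eb; rewrite (joinsP _ _ _ _ je) eq_sym (negPf xb) => /eqP by'.
    have xn : x \in nbhd I L b.
      by rewrite inE; apply/existsP; exists e; rewrite eL joinsC by' je.
    move: xU; rewrite merge_nbr // => /h1; rewrite /cde /cdead eqxx negb_or.
    rewrite negb_and -by'; move: cx; rewrite (nbr_col bicol xn) negbK => -> /=.
    by case/andP=> _ /andP [].
  have eL' : e \in cL by rewrite in_setD inE eb.
  have [_ yb] := outside_star bicol eL' je.
  by apply: undead => //; apply: h2 eL' (joins_cinc L b je) xU.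
- move=> e x y eL je; rewrite !inE => xY; have [eb|eb] := boolP (I e b).
    suff -> : merge y = merge x by rewrite xY.
    have lxy : link I L x y by apply/existsP; exists e; rewrite eL.
    move: eb lxy; rewrite (joinsP _ _ _ _ je).
    case: eqP => [<- _ lby|_ /= /eqP <- lxb].
      by rewrite (merge_b b bicol) merge_nbr // inE.
    by rewrite (merge_b b bicol) merge_nbr // inE link_sym.
  have eL' : e \in cL by rewrite in_setD inE eb.
  have [_ yb] := outside_star bicol eL' je.
  have := h3 _ _ _ eL' (joins_cinc L b je) xY; rewrite inE => /orP [->//|yU].
  rewrite yU andbT; have /h1 /andP [] := yU.
  by rewrite /ccl ccol_merge // => ->; rewrite orbT.
- by rewrite (eq_bigl (fun y => merge y \in p.2)) -?push_sum // => y; rewrite inE.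
Qed.

(** T is even in total and contains b, so it is odd on the remaining nodes. *)
Lemma odd_cut_center : \big[addb/false]_x T x = false -> T b -> ~~ col b -> ~~ dead b ->
  ~~ [exists y in nbhd I L b, dead y] -> odd_cut I L col T dead ([set b], ~: [set b]).
Proof.
move=> T0 Tb cb db dn; split=> /=.
- by move=> u; rewrite inE => /eqP ->; rewrite cb.
- move=> e x y eL je; rewrite inE => /eqP xb; apply: contraNN dn => dy.
  apply/existsP; exists y; rewrite dy andbT inE; apply/existsP; exists e.
  by rewrite eL -xb.
- by move=> e x y _ _ _; rewrite !inE orNb.
- move: T0; rewrite (bigD1 b) //= Tb (eq_bigl (mem (~: [set b]))); last first.
    by move=> x; rewrite !inE.
  by case: (\big[_/_]_(_ in _) _).
Qed.

(** After contraction b is on the face side, hence in the first component of no cut. *)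
Lemma center_pull p : ~~ col b -> odd_cut cI cL ccl cT cde p ->
  disjoint_cuts ([set b], ~: [set b]) (pull p).
Proof.
move=> cb [h1 _ _ _]; rewrite /disjoint_cuts disjoints1 inE /= (merge_b b bicol) negb_and.
by apply/orP; right; apply/negP => /h1; rewrite /ccl /ccol eqxx cb.
Qed.

End PullBack.

(** * Induction on the number of nodes *)

Section PackingInduction.
Variables (E N : finType).

(* [W] is the set of current nodes: contraction isolates the absorbed ones without
   removing them from [N]. *)
Lemma join_cut_packing n (I : E -> N -> bool) (L : {set E}) (col T dead : pred N)
    (W : {set N}) x0 :
  #|W| <= n ->
  (forall e, e \in L -> exists x y,
     [/\ x \in W, y \in W & [/\ col x, ~~ col y & joins I e x y]]) ->
  (forall x, T x -> x \in W) -> x0 \in W ->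
  (forall x, x \in W -> connect (link I L) x x0) ->
  \big[addb/false]_x T x = false ->
  exists (J : {set E}) (ps : seq ({set N} * {set N})),
    [/\ J \subset L, (forall z, bd I J z = T z),
        (forall p, p \in ps -> odd_cut I L col T dead p),
        pairwise (@disjoint_cuts N) ps &
        #|J| <= 2 * size ps + \sum_(x in W | x != x0) potential col T dead x].
Proof.
elim: n I L col T dead W x0 => [|n IH] I L col T dead W x0 leWn bicolW TW x0W cW T0.
  by move: leWn; rewrite leqn0 cards_eq0 => /eqP W0; rewrite W0 inE in x0W.
have bicol e : e \in L -> exists x y, [/\ col x, ~~ col y & joins I e x y].
  by move=> /bicolW [x [y [_ _ h]]]; exists x, y.
(* Pairs (J, y) with J a join for T + x0 + y: the join and its extra end are minimised together. *)
pose P (q : {set E} * N) :=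
  (q.1 \subset L) && [forall z, bd I q.1 z == T z (+) (z == x0) (+) (z == q.2)].
have [|J0 J0L bJ0] := @join_exists _ _ I L x0 T _ T0.
  by move=> x /TW /cW.
have PJ0 : P (J0, x0).
  rewrite /P J0L; apply/forallP => z; rewrite bJ0 /=.
  by rewrite -addbA addbb addbF.
case: (arg_minnP (fun q : {set E} * N => #|q.1|) PJ0) => -[B b].
rewrite {1}/P /= => /andP [BL /forallP bdB'] Bmin'.
pose S z := T z (+) (z == x0).
have bdB z : bd I B z = S z (+) (z == b) by apply/eqP.
have Bmin (J : {set E}) y : J \subset L ->
    (forall z, bd I J z = S z (+) (z == y)) -> #|B| <= #|J|.
  move=> JL bJ; apply: (Bmin' (J, y)); rewrite /P JL; apply/forallP => z.
  by apply/eqP/bJ.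
have Sb : S b := T0b bicol BL bdB Bmin.
have bW : b \in W.
  by move: Sb; rewrite /S; case: (b =P x0) => [->//|_]; rewrite addbF => /TW.
have inW e x : e \in L -> I e x -> x \in W.
  move=> /bicolW [u [v [uW vW [_ _ /joinsP ->]]]].
  by case: eqP => [->|_ /= /eqP ->].
have nbrW y : y \in nbhd I L b -> y \in W.
  move=> yn; have := yn; rewrite inE => /existsP [e /andP [eL je]].
  apply: (inW e) => //; rewrite (joinsP _ _ _ _ je) eqxx.
  by rewrite (_ : y == b = false) //; apply: contraTF yn => /eqP ->; rewrite (nbr_b b bicol).
(* If b has no neighbour, connectedness leaves b as the only node, and T is empty because it is
   even. *)
have [n0|[y0 y0n]] := set_0Vmem (nbhd I L b).
  have onlyb x : x \in W -> x = b.
    move=> xW; have : connect (link I L) b x.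
      by rewrite link_csym (connect_trans (cW _ xW)) // link_csym cW.
    case/connectP => -[//|z p] /= /andP [bz _].
    by have : z \in nbhd I L b; [rewrite inE|rewrite n0 inE].
  have Tz z : T z = false.
    apply/negP => Tz; have zb := onlyb _ (TW _ Tz).
    move: T0; rewrite (bigD1 b) //= big1 => [|x]; first by rewrite -zb Tz.
    by apply: contraNF => /TW /onlyb ->.
  exists set0, [::]; split=> //; rewrite ?sub0set ?cards0 //.
  by move=> z; rewrite bd0 Tz.
pose mg := merge I L b.
have mW x : x \in W -> mg x \in W :\: nbhd I L b.
  move=> xW; rewrite inE /mg; have [xn|xn] := boolP (x \in nbhd I L b).
    by rewrite merge_nbr // (nbr_b b bicol) bW.
  by rewrite merge_id // xn xW.
(* Both b and y0 merge into b, so adding them to T does not change its image. *)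
have push_x0 z : push I L b (fun x => T x (+) (x == b) (+) (x == y0)) z = push I L b T z.
  rewrite (eq_push _ _ _ _ (D' := fun x => T x (+) ((x == b) (+) (x == y0)))); last first.
    by move=> x; rewrite addbA.
  rewrite push_addb push_addb !push_eq1 (merge_b _ bicol) merge_nbr // addbb.
  exact: addbF.
have [||||||J' [ps' [J'L bJ' cuts' disj' size']]] := IH (cinc I L b)
    (L :\: star I b) (ccol col b) (push I L b T) (cdead I L col b dead)
    (W :\: nbhd I L b) (mg x0).
- have := cardsID (nbhd I L b) W.
  have : 0 < #|W :&: nbhd I L b| by apply/card_gt0P; exists y0; rewrite inE nbrW.
  by move: leWn; clear; lia.
- move=> e eL'; have eL : e \in L by move: eL'; rewrite inE => /andP [].
  have [x [y [xW yW [cx cy je]]]] := bicolW _ eL.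
  have [xb yb] := outside_star bicol eL' je.
  exists (mg x), (mg y); split; try exact: mW.
  by rewrite !ccol_merge //; split=> //; apply: joins_cinc.
- move=> x; apply: contraTT => xW; rewrite /push big1 // => y /eqP myx.
  by apply: contraNF xW => /TW /mW; rewrite /mg myx.
- exact: mW.
- move=> x; rewrite inE => /andP [xn /cW /(connect_contract b bicol)].
  by rewrite (merge_id xn).
- by rewrite push_sum (eq_bigl xpredT).
have step : exists J : {set E}, [/\ J \subset L, forall z, bd I J z = T z
    & #|J| <= #|J'| + (x0 != b)].
  have [x0b|x0b] := eqVneq x0 b.
    (* For x0 = b, lifting to T + b + y0 instead of T yields a competitor A' of B. Since b and y0
       lie on opposite sides, |B| and |A'| differ in parity, so |B| < |A'| <= |J'| + 1. The T-join
       sought is B itself. *)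
    have [|A [AL bA AJ]] := @lift_join _ _ I L col b bicol J'
        (fun x => T x (+) (x == b) (+) (x == y0)) J'L.
      by move=> z; rewrite bJ' push_x0.
    have bA' z : bd I A z = S z (+) (z == y0) by rewrite bA /S x0b.
    have [A' [A'L bA'' leA]] := star_once bicol BL bdB Bmin AL bA'.
    have leB := Bmin _ _ A'L bA''.
    have oB : odd #|B| != odd #|A'|.
      rewrite (@join_parity _ _ I B col); last by move=> e /(subsetP BL) /bicol.
      rewrite (@join_parity _ _ I A' col); last by move=> e /(subsetP A'L) /bicol.
      rewrite (eq_bigr _ (fun x _ => bdB x)) (eq_bigr _ (fun x _ => bA'' x)).
      rewrite !big_split /= !big_addb_eq1 (nbr_col bicol y0n).
      by case: (\big[_/_]_(_ | _) _); case: (col x0); case: (col b).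
    exists B; split=> //.
      by move=> z; rewrite bdB /S x0b -addbA addbb addbF.
    have nB : #|B| <> #|A'| by move=> h; rewrite h eqxx in oB.
    by move: nB leB leA; rewrite AJ; clear; lia.
  have [A [AL bA AJ]] := lift_join bicol J'L bJ'.
  have bA' z : bd I A z = S z (+) (z == x0) by rewrite bA /S -addbA addbb addbF.
  have [A' [A'L bA'' leA]] := star_once bicol BL bdB Bmin AL bA'.
  exists A'; split => //; last by rewrite addn1 -AJ.
  by move=> z; rewrite bA'' /S -addbA addbb addbF.
have [J [JL bJ leJ]] := step.
pose good := [&& ~~ col b, ~~ dead b, ~~ [exists y in nbhd I L b, dead y] & x0 != b].
exists J, ((if good then [:: ([set b], ~: [set b])] else [::]) ++ map (pull I L col b) ps').
have Tb : x0 != b -> T b.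
  by move=> nb; move: Sb; rewrite /S eq_sym (negPf nb) addbF.
split=> //.
- move=> p; rewrite mem_cat => /orP [|/mapP [q qps ->]]; last first.
    exact: odd_cut_pull bicol _ _ _ (cuts' _ qps).
  case: ifP => //; rewrite /good inE => /and4P [cb db dn nb] /eqP ->.
  exact: odd_cut_center T0 (Tb nb) cb db dn.
- have pp : pairwise (@disjoint_cuts N) (map (pull I L col b) ps').
    rewrite pairwise_map; apply: sub_pairwise disj' => p q.
    exact: disjoint_pull.
  case: ifP => //= /and4P [cb db dn nb]; rewrite pp andbT.
  apply/allP => q /mapP [r rps ->].
  exact: center_pull bicol _ _ _ cb (cuts' _ rps).
apply: leq_trans leJ _; rewrite size_cat size_map.
set pt := potential col T dead.
set cpt := potential _ _ _ in size'.
(* R is the potential common to both graphs; only the star and the contracted node differ. *)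
pose R := \sum_(x in W | [&& x \notin nbhd I L b, x != b & x != x0]) pt x.
pose Rn := \sum_(x in nbhd I L b | x != x0) pt x.
have sumE : \sum_(x in W | x != x0) pt x = Rn + ((x0 != b) * pt b + R).
  rewrite (bigID (mem (nbhd I L b))) /=; congr (_ + _).
    apply: eq_bigl => x; case xn: (x \in nbhd I L b); rewrite ?andbF //.
    by rewrite nbrW // andbT.
  have [x0b|x0b] := eqVneq x0 b.
    rewrite mul0n; apply: eq_bigl => x; rewrite x0b.
    by case: (x \in W); case: (x == b); case: (x \in nbhd I L b).
  rewrite mul1n (bigD1 b) /= ?bW 1?eq_sym ?x0b ?(nbr_b b bicol) //.
  congr (_ + _); apply: eq_bigl => x.
  by case: (x \in W); case: (x == b); case: (x == x0); case: (x \in nbhd I L b).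
have sumE' : \sum_(x in W :\: nbhd I L b | x != mg x0) cpt x
    = (mg x0 != b) * cpt b + R.
  have RE : \sum_(x in W | [&& x \notin nbhd I L b, x != b & x != x0]) cpt x = R.
    apply: eq_bigr => x /andP [_ /and3P [xn xb _]].
    by rewrite /cpt /pt /potential /ccol /cdead (negPf xb) push_id.
  have [x0b|x0b] := eqVneq (mg x0) b.
    rewrite mul0n -RE; apply: eq_bigl => x; rewrite inE x0b.
    case xn: (x \in nbhd I L b); rewrite ?andbF //=; congr (_ && _).
    have [//|xb] := eqVneq x b; symmetry; apply: contraNneq xb => xx0.
    by rewrite -x0b /mg -xx0 merge_id ?xn.
  have x0n : x0 \notin nbhd I L b by apply: contraNN x0b => /merge_nbr; rewrite /mg => ->.
  have x0b' : x0 != b by move: x0b; rewrite /mg merge_id.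
  rewrite mul1n (bigD1 b) /=; last first.
    by rewrite inE (nbr_b b bicol) bW /mg merge_id // eq_sym.
  congr (_ + _); rewrite -RE; apply: eq_bigl => x; rewrite inE /mg merge_id //.
  by case: (x \in W); case: (x == b); case: (x == x0); case: (x \in nbhd I L b).
rewrite sumE; rewrite sumE' in size'.
have sgood : size (if good then [:: ([set b], ~: [set b])] else [::]) = good.
  by case: good.
rewrite sgood.
have [x0b|x0b] := eqVneq (mg x0) b.
  (* The contracted node is the new root and has no potential. If b was not the old root, its own
     positive potential pays for the extra edge. *)
  rewrite x0b eqxx mul0n in size'.
  have [b0|b0] := eqVneq x0 b; first by move: size'; clear; lia.
  suff : 0 < pt b by rewrite mul1n; move: size'; clear; lia.
  by rewrite /pt /potential /pot Tb //; case: (col b); case: (dead b).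
rewrite x0b mul1n in size'.
have x0n : x0 \notin nbhd I L b by apply: contraNN x0b => /merge_nbr; rewrite /mg => ->.
have nb : x0 != b by move: x0b; rewrite /mg merge_id.
rewrite nb mul1n.
(* The extra edge is paid by the drop of potential at the star, or by the 2 that {b} brings when it
   joins the packing. After [pot_sum], a check over the values of [col b], [dead b], t and d
   remains. *)
suff : cpt b + 1 <= 2 * good + Rn + pt b by move: size'; clear; lia.
have := @pot_sum N (mem (nbhd I L b)) col T dead (~~ col b) (fun x => nbr_col bicol (y := x)).
rewrite /= (_ : \sum_(_ | _) _ = Rn); last first.
  apply: eq_bigl => x /=; case xn: (x \in nbhd I L b) => //=.
  by symmetry; apply: contraNneq x0n => <-.
set t := \big[_/_]_(_ | _) _; set d := [exists _ in _, _].
have cTb : push I L b T b = ~~ t.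
  rewrite /push (bigD1 b) /= ?(merge_b _ bicol) // Tb //=; congr (~~ _).
  apply: eq_bigl => x; rewrite /merge; case xn: (x \in nbhd I L b).
    by rewrite eqxx; apply: contraTneq xn => ->; rewrite (nbr_b b bicol).
  by case: (x == b).
rewrite /pt /cpt /potential cTb /ccol /cdead eqxx -/d Tb // /good nb andbT -/d.
clearbody t d; rewrite /pot; clear.
by case: (col b); case: (dead b); case: t; case: d => /=; lia.
Qed.

End PackingInduction.

Definition incident (V : finType) (A : {set V}) (v : V) : bool := v \in A.

(** * Cycle space of a plane graph *)

Section Edges.
Variables (V : finType) (G : signed_graph V).

Lemma adj_sym : symmetric (adj G).
Proof. by move=> u v; rewrite /adj /= setUC. Qed.

Lemma adj_neq u v : adj G u v -> u != v.
Proof. by move=> /edges_card2; rewrite cards2; case: (u == v). Qed.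

Lemma edge_ends A : A \in edges G -> exists u v, A = [set u; v] /\ adj G u v.
Proof.
move=> AE; have /eqP/cards2P [u [v [_ Auv]]] := edges_card2 AE.
by exists u, v; rewrite /adj /= -Auv.
Qed.

Lemma joins_edge u v : u != v -> joins (@incident V) [set u; v] u v.
Proof.
move=> nuv; apply/joinsP => z; rewrite /incident !inE.
by case: (eqVneq z u) nuv => [->|]; case: (eqVneq z v) => // ->; rewrite eqxx.
Qed.

Lemma adj_link u v : adj G u v -> link (@incident V) (edges G) u v.
Proof.
move=> a; apply/existsP; exists [set u; v].
by rewrite joins_edge ?adj_neq // andbT.
Qed.

Lemma edges_at v (Q : pred {set V}) :
  \big[addb/false]_(A in edges G | v \in A) Q A
    = \big[addb/false]_(w | adj G v w) Q [set v; w].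
Proof.
rewrite (eq_bigl (mem ((fun w => [set v; w]) @: [set w | adj G v w]))); last first.
  move=> A; apply/andP/imsetP => [[AE vA]|[w]]; last first.
    by rewrite inE => a ->; rewrite !inE eqxx.
  have [u [w [Auw a]]] := edge_ends AE; move: vA; rewrite Auw !inE.
  case/orP => /eqP ->; first by exists w; rewrite ?inE.
  by exists u; rewrite ?inE 1?adj_sym // setUC.
rewrite big_imset /=; first by apply: eq_bigl => w; rewrite inE.
move=> w1 w2; rewrite !inE => a1 a2 /setP /(_ w1).
rewrite !inE eqxx orbT eq_sym (negPf (adj_neq a1)) /=.
by move=> /esym /eqP.
Qed.

End Edges.

Section CycleSpace.
Variables (V F : finType) (G : signed_graph V) (M : embedding G F).
Implicit Types (X : {set F}) (A : {set V}) (Z : {set {set V}}).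

Definition parts X (u v : V) : bool := (face M u v \in X) (+) (face M v u \in X).

(** The cut of X in the dual graph; an edge with the same face on both sides never belongs to it. *)
Definition cobord X : {set {set V}} :=
  [set A in edges G | [exists u, exists v, (A == [set u; v]) && parts X u v]].

Lemma partsC X u v : parts X u v = parts X v u.
Proof. exact: addbC. Qed.

Lemma set2_eq (u v w z : V) : [set u; v] = [set w; z] ->
  (u = w /\ v = z) \/ (u = z /\ v = w).
Proof.
move/setP=> h; have := h u; have := h v; have := h w; have := h z.
rewrite !inE !eqxx ?orbT /= => hz hw /esym /orP [] /eqP vE /esym /orP [] /eqP uE; subst.
- by move: hz => /orP [] /eqP ->; left.
- by right.
- by left.
- by move: hw => /orP [] /eqP ->; left.
Qed.

Lemma cobordE X u v : adj G u v -> ([set u; v] \in cobord X) = parts X u v.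
Proof.
move=> a; rewrite inE; have -> /= : [set u; v] \in edges G by [].
apply/existsP/idP => [[w /existsP [z /andP [/eqP /set2_eq + p]]]|p].
  by case=> -[-> ->] //; rewrite partsC.
by exists u; apply/existsP; exists v; rewrite eqxx.
Qed.

Lemma cobord_sub X : cobord X \subset edges G.
Proof. by apply/subsetP => A; rewrite inE => /andP []. Qed.

Lemma cobord_symd X Y : cobord (symd X Y) = symd (cobord X) (cobord Y).
Proof.
apply/setP => A; rewrite in_symd; have [AE|nA] := boolP (A \in edges G); last first.
  by rewrite !inE (negPf nA).
have [u [v [-> a]]] := edge_ends AE; rewrite !cobordE // /parts !in_symd.
by rewrite -!addbA; congr (_ (+) _); rewrite addbCA.
Qed.

Lemma rotation_nbr v w : adj G v w -> adj G v (rotation M v w).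
Proof.
move=> a; have := rotationP M a => /setP /(_ (rotation M v w)).
by rewrite inE -[rotation M v w]/((rotation M v ^+ 1)%g w) mem_porbit => <-.
Qed.

Lemma rotation_adj v w : adj G v (rotation M v w) = adj G v w.
Proof.
apply/idP/idP => [a|]; last exact: rotation_nbr.
have := rotationP M a => /setP /(_ w); rewrite inE => <-.
by rewrite porbit_sym -[rotation M v w]/((rotation M v ^+ 1)%g w) mem_porbit.
Qed.

(** By [faceP], the face on one side of vw is the face on the other side of the next edge around v.
    Summed over the neighbours of v, the two sides cancel. *)
Lemma bd_cobord X v : bd (@incident V) (cobord X) v = false.
Proof.
rewrite /bd /incident big_mkcond /=.
rewrite (eq_bigr (fun A => if (A \in edges G) && (v \in A) then A \in cobord X else false)).
  rewrite -big_mkcond /= (@edges_at _ G v (mem (cobord X))).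
  rewrite (eq_bigr (fun w => parts X v w)); last by move=> w a; rewrite /= cobordE.
  rewrite big_split /= (reindex_inj (@perm_inj _ (rotation M v))) /=.
  rewrite (eq_bigl (adj G v)); last by move=> w; rewrite rotation_adj.
  rewrite (eq_bigr (fun w => face M w v \in X)) ?addbb // => w a.
  by rewrite faceP // adj_sym.
move=> A _; case AC: (A \in cobord X); last by case: ifP.
by rewrite (subsetP (cobord_sub X) _ AC); case: (v \in A).
Qed.

Lemma boundary_face u v : adj G u v -> u \in boundary M (face M u v).
Proof. by move=> a; rewrite inE; apply/orP; left; apply/existsP; exists v; rewrite a eqxx. Qed.

Lemma boundary_face_rev u v : adj G u v -> u \in boundary M (face M v u).
Proof.
move=> a; rewrite -(@faceP _ _ _ M v u) 1?adj_sym //.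
by apply: boundary_face; apply: rotation_nbr.
Qed.

(** Turning around v meets all its faces without crossing an edge of the coboundary. *)
Lemma face_agree X v f g : (forall A, A \in cobord X -> v \notin A) ->
  v \in boundary M f -> v \in boundary M g -> (f \in X) = (g \in X).
Proof.
move=> nX; rewrite !inE => vf vg.
have [iv|niv] := boolP (isolated G v).
  have no h : ([exists w, adj G v w && (face M v w == h)]) = false.
    by apply/existsP => -[w /andP [a _]]; move/forallP/(_ w): iv; rewrite a.
  by move: vf vg; rewrite !no iv /= => /eqP <- /eqP <-.
move: vf vg; rewrite (negPf niv) !orbF.
case/existsP => w /andP [aw /eqP <-] /existsP [z /andP [az /eqP <-]].
have : z \in porbit (rotation M v) w by rewrite rotationP // inE.
case/porbitP => i ->; elim: i => [|i ->]; first by rewrite expg0 perm1.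
rewrite expgSr permM; set y := ((rotation M v ^+ i)%g w).
have ay : adj G v y.
  have := rotationP M aw => /setP /(_ y); rewrite mem_porbit inE => <- //.
rewrite faceP 1?adj_sym //.
have : [set v; y] \notin cobord X.
  by apply: contraL (isT : true) => /nX; rewrite !inE eqxx.
by rewrite cobordE // /parts; case: (_ \in X); case: (_ \in X).
Qed.

End CycleSpace.

Section Plane.
Variables (V F : finType) (G : signed_graph V) (M : embedding G F).
Hypothesis hplane : plane M.
Implicit Types (X : {set F}) (A : {set V}) (Z : {set {set V}}).

Lemma cobord_eq0 X f g : cobord M X = set0 -> (f \in X) = (g \in X).
Proof.
move=> X0; have [+ _] := hplane => /(_ f g) /connectP [p].
elim: p f => [|h p IH] f /=; first by move=> _ ->.
case/andP=> /pred0Pn [v /= /andP [vf vh]] /IH IHp /IHp <-.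
by apply: face_agree vf vh => A; rewrite X0 inE.
Qed.

Variable f0 : F.

(** A counting argument. Each vertex v gets a path [P v] to the root of its component. A set of
    faces without f0 and a set Q of non-root vertices are sent to the coboundary of the former plus
    the paths from Q. This map is injective, hence onto the sets of edges by Euler's formula. For a
    set with zero boundary, Q is empty. *)
Lemma cycle_cobord Z : Z \subset edges G -> (forall v, bd (@incident V) Z v = false) ->
  exists X, Z = cobord M X.
Proof.
move=> ZE bZ.
pose nr := [set v | root (adj G) v != v].
have csym : connect_sym (adj G) by apply: sym_connect_sym; apply: adj_sym.
have /fin_all_exists [P PP] : forall v, exists Q : {set {set V}}, Q \subset edges G /\
    forall z, bd (@incident V) Q z = (z == v) (+) (z == root (adj G) v).
  move=> v; have [|Q QE bQ] := @path_chain _ _ (@incident V) (edges G) v (root (adj G) v).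
    by apply: connect_sub (connect_root (adj G) v) => u w /adj_link /connect1.
  by exists Q.
pose J (Q : {set V}) := [set A | \big[addb/false]_(v in Q) (A \in P v)].
have JE Q : J Q \subset edges G.
  apply/subsetP => A; rewrite inE; apply: contraTT => nA; rewrite big1 // => v _.
  by apply: contraNF nA; have [/subsetP h _] := PP v; apply: h.
(* Among non-root vertices, [P v] has v as its only boundary point. *)
have bJ (Q : {set V}) z : Q \subset nr -> z \in nr -> bd (@incident V) (J Q) z = (z \in Q).
  move=> Qn zn; rewrite /bd.
  transitivity (\big[addb/false]_(v in Q) bd (@incident V) (P v) z).
    rewrite /bd; under [RHS]eq_bigr do rewrite big_mkcond /=.
    rewrite exchange_big /= big_mkcond; apply: eq_bigr => A _.
    rewrite inE [RHS](eq_bigr (fun v => (A \in P v) && incident A z)) => [|v _].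
      by rewrite -big_distrl /=; case: (\big[_/_]_(_ in _) _).
    by case: ifP.
  rewrite (eq_bigr (fun v => (v == z) (+) false)) => [|v vQ].
    by rewrite big_split /= big_addb_eq1 big1_eq addbF.
  have [_ ->] := PP v; rewrite [z == v]eq_sym; congr (_ (+) _).
  apply: contraTF zn => /eqP ->; rewrite inE negbK.
  by rewrite root_root.
pose D := setX (powerset (~: [set f0])) (powerset nr).
pose h (p : {set F} * {set V}) := symd (cobord M p.1) (J p.2).
have h_inj : {in D &, injective h}.
  move=> [X Q] [X' Q']; rewrite /D !inE /= /h /= => /andP [X0 Qn] /andP [X0' Qn'] hE.
  have bdh Y R z : bd (@incident V) (symd (cobord M Y) (J R)) z = bd (@incident V) (J R) z.
    by rewrite bd_symd bd_cobord.
  have QQ : Q = Q'.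
    apply/setP => z; have [zn|zn] := boolP (z \in nr).
      by rewrite -(bJ Q) // -(bJ Q') // -(bdh X) hE bdh.
    by apply/idP/idP => [/(subsetP Qn)|/(subsetP Qn')]; rewrite (negPf zn).
  subst Q'; congr (_, _).
  have c0 : cobord M (symd X X') = set0.
    apply/setP => A; rewrite cobord_symd in_symd in_set0.
    have /setP /(_ A) := hE; rewrite !in_symd.
    by case: (A \in J Q); case: (A \in cobord M X); case: (A \in cobord M X').
  apply/setP => f; have := cobord_eq0 f f0 c0; rewrite !in_symd.
  have nf (Y : {set F}) : Y \subset ~: [set f0] -> f0 \in Y = false.
    by move=> /subsetP s; apply/negP => /s; rewrite !inE eqxx.
  by rewrite !nf //; case: (f \in X); case: (f \in X').
have cD : #|h @: D| = #|powerset (edges G)|.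
  rewrite card_in_imset // cardsX !card_powerset cardsC1 -expnD; congr (2 ^ _).
  (* Euler's formula in the form (|F| - 1) + (|V| - number of components) = |E|. *)
  have [_] := hplane; have Fp : 0 < #|F| by apply/card_gt0P; exists f0.
  have -> : n_comp (adj G) predT = #|~: nr|.
    by apply: eq_card => v; rewrite !inE negbK andbT.
  have := cardsC nr; lia.
have hD : h @: D = powerset (edges G).
  apply/eqP; rewrite eqEcard cD leqnn andbT; apply/subsetP => _ /imsetP [[X Q] _ ->].
  by rewrite inE; apply: symd_sub; rewrite ?cobord_sub.
have : Z \in h @: D by rewrite hD inE.
case/imsetP => -[X Q]; rewrite !inE /= => /andP [_ Qn] ZE'.
have Q0 : Q = set0.
  apply/setP => z; rewrite inE; apply/negP => zQ; have := bZ z.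
  by rewrite ZE' bd_symd bd_cobord bJ ?zQ // (subsetP Qn).
exists X; rewrite ZE' /h /= Q0; apply/setP => A.
by rewrite in_symd [A \in J _]inE big_set0 addbF.
Qed.

End Plane.

(** * Parity of even edge sets and odd cycles *)

Section CycleParity.
Variables (V : finType) (G : signed_graph V).
Implicit Types (A : {set V}) (Z : {set {set V}}) (c : seq V).

Definition parity Z : bool := \big[addb/false]_(A in odd_edges G) (A \in Z).

Lemma parity_symd Z1 Z2 : parity (symd Z1 Z2) = parity Z1 (+) parity Z2.
Proof. by rewrite -big_split; apply: eq_bigr => A _; rewrite in_symd. Qed.

Lemma parity_mem Z : parity Z = \big[addb/false]_(A in Z) (A \in odd_edges G).
Proof.
rewrite /parity big_mkcond [RHS]big_mkcond; apply: eq_bigr => A _.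
by case: (A \in Z); case: (A \in odd_edges G).
Qed.

Lemma odd_edge A : A \in odd_edges G -> A \in edges G.
Proof. exact/subsetP/odd_edges_sub. Qed.

(* An even edge set has an even number of edges across every vertex cut. *)
Lemma even_connect Z u v : Z \subset edges G ->
  (forall x, bd (@incident V) Z x = false) -> adj G u v -> [set u; v] \in Z ->
  connect [rel x y | ([set x; y] \in Z) && ([set x; y] != [set u; v])] u v.
Proof.
move=> ZE bZ auv uvZ; set r := (X in connect X).
have rs : connect_sym r.
  by apply: sym_connect_sym => x y; rewrite /r /= setUC.
have := bd_cut (@incident V) Z (connect r u).
rewrite big1; last by move=> x _; exact: bZ.
rewrite (bigD1 [set u; v]) //=.
rewrite (joins_cut _ (joins_edge (adj_neq auv))) connect0 big1 ?addbF.
  by case: (connect r u v).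
move=> A /andP [AZ nA]; have [x [y [AE a]]] := edge_ends (subsetP ZE _ AZ).
rewrite AE in AZ nA *; rewrite (joins_cut _ (joins_edge (adj_neq a))).
have rxy : r x y by rewrite /r /= AZ.
by rewrite (same_connect_r rs (connect1 rxy)) addbb.
Qed.

(** Defined as a sum modulo 2 so that sums over it become sums along c without proving the edges
    distinct. *)
Definition cycle_edges c : {set {set V}} :=
  [set A | \big[addb/false]_(x <- c) ([set x; next c x] == A)].

Lemma cycle_edges_sum c (Q : pred {set V}) :
  \big[addb/false]_(A in cycle_edges c) Q A
    = \big[addb/false]_(x <- c) Q [set x; next c x].
Proof.
transitivity (\big[addb/false]_(A : {set V}) \big[addb/false]_(x <- c)
    (([set x; next c x] == A) && Q A)).
  rewrite big_mkcond; apply: eq_bigr => A _; rewrite -big_distrl inE /=.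
  by case: (\big[_/_]_(_ <- _) _).
rewrite exchange_big; apply: eq_bigr => x _ /=.
rewrite (bigD1 [set x; next c x]) //= eqxx big1 ?addbF // => A.
by rewrite eq_sym => /negPf ->.
Qed.

Lemma cycle_edgesP c A : A \in cycle_edges c ->
  exists2 x, x \in c & A = [set x; next c x].
Proof.
rewrite inE => h; have : has (fun x => [set x; next c x] == A) c.
  apply: contraLR h => /hasPn h; rewrite big_seq big1 // => x /h.
  by case: eqP.
by case/hasP => x xc /eqP <-; exists x.
Qed.

Lemma next_adj c x : is_cycle G c -> x \in c -> adj G x (next c x).
Proof. by case/andP=> _ /andP [cc _]; apply: next_cycle. Qed.

Lemma cycle_edges_sub c : is_cycle G c -> cycle_edges c \subset edges G.
Proof.
move=> cc; apply/subsetP => A /cycle_edgesP [x xc ->]; exact: next_adj.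
Qed.

Lemma bd_cycle_edges c z : is_cycle G c -> bd (@incident V) (cycle_edges c) z = false.
Proof.
move=> cc; have uc : uniq c by case/andP: cc => _ /andP [].
rewrite /bd (@cycle_edges_sum c (fun A => incident A z)).
rewrite big_seq (eq_bigr (fun x => (z == x) (+) (prev c z == x))).
  rewrite -big_seq big_split /= !big_addb_eq1_seq //.
  by rewrite mem_prev addbb.
move=> x xc; have /joinsP -> := joins_edge (adj_neq (next_adj cc xc)).
congr (_ (+) _); apply/eqP/eqP => [->|<-]; first by rewrite prev_next.
by rewrite next_prev.
Qed.

Lemma parity_cycle_edges c :
  parity (cycle_edges c) = odd (count [pred x | [set x; next c x] \in odd_edges G] c).
Proof.
rewrite parity_mem (@cycle_edges_sum c (mem (odd_edges G))) -sum1_count.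
rewrite (big_morph odd oddD (erefl _)) [RHS]big_mkcond.
by apply: eq_bigr => x _ /=; case: ifP.
Qed.

(** By [even_connect], an edge of Z lies on a cycle inside Z. If that cycle is even, adding it to Z
    keeps Z odd and makes it smaller. *)
Lemma odd_cycle_exists Z : Z \subset edges G ->
  (forall x, bd (@incident V) Z x = false) -> parity Z ->
  exists2 c, odd_cycle G c & forall x, x \in c -> exists2 A, A \in Z & x \in A.
Proof.
move: {2}_.+1 (ltnSn #|Z|) => n; elim: n Z => // n IH Z ltZn ZE bZ pZ.
have [A AZ] : exists A, A \in Z.
  apply/set0Pn; apply: contraTneq pZ => ->.
  by rewrite /parity big1 // => A _; rewrite inE.
have [u [v [Auv auv]]] := edge_ends (subsetP ZE _ AZ); rewrite Auv in AZ.
have /connectP [p0 rp0 vE0] := even_connect ZE bZ auv AZ.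
set r := (X in path X) in rp0; move: vE0.
case/shortenP: rp0 => p rp up _ vE {p0}.
have rZ x y : r x y -> [set x; y] \in Z by case/andP.
(* The path from u to v avoids the edge uv, so it has an inner vertex. *)
have sp : 2 < size (u :: p).
  case: p rp vE {up} => [|x [|y p]] //=; first by move=> _ vu; move: (adj_neq auv); rewrite vu eqxx.
  by rewrite andbT => ru vx; move: ru; rewrite /r /= vx eqxx andbF.
pose r' : rel V := [rel x y | r x y || (x == v) && (y == u)].
have cr' : path.cycle r' (u :: p).
  rewrite /= rcons_path -vE /r' /= !eqxx orbT andbT.
  by apply: sub_path rp => x y /= ->.
have next_r x : x \in u :: p -> r' x (next (u :: p) x) by apply: next_cycle.
have r'Z x y : r' x y -> [set x; y] \in Z.
  by case/orP => [/rZ //|/andP [/eqP -> /eqP ->]]; rewrite setUC.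
have cc : is_cycle G (u :: p).
  rewrite /is_cycle sp /ucycleb up andbT /=.
  by apply: sub_path cr' => x y /r'Z /(subsetP ZE).
have cZ A' : A' \in cycle_edges (u :: p) -> A' \in Z.
  by case/cycle_edgesP => x xc ->; apply/r'Z/next_r.
have vc : v \in u :: p by rewrite vE mem_last.
have next_v : next (u :: p) v = u.
  by rewrite next_nth vc [in index _ _]vE index_last // nth_default.
have Ac : [set u; v] \in cycle_edges (u :: p).
  rewrite inE (bigD1_seq v) // next_v setUC eqxx big_seq_cond big1 // => x.
  case/andP=> /next_r /orP [/andP [_ /negPf]//|/andP [/eqP -> _]].
  by rewrite eqxx.
have [oc|oc] := boolP (odd_cycle G (u :: p)).
  exists (u :: p) => // x xc; exists [set x; next (u :: p) x].
    by apply/r'Z/next_r.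
  by rewrite !inE eqxx.
have [||||c oc' cZ'] := IH (symd Z (cycle_edges (u :: p))).
- rewrite -ltnS; apply: leq_trans ltZn; rewrite ltnS; apply: proper_card; apply/properP; split.
    by apply/subsetP => A'; rewrite in_symd; have := @cZ A'; case: (A' \in Z) => // -> .
  by exists [set u; v]; rewrite // in_symd AZ Ac.
- by apply: symd_sub => //; apply: cycle_edges_sub.
- by move=> x; rewrite bd_symd bZ bd_cycle_edges.
- by rewrite parity_symd pZ parity_cycle_edges; move: oc; rewrite /odd_cycle cc.
exists c => // x /cZ' [A' + xA']; rewrite in_symd => A'Z; exists A' => //.
by move: A'Z; have := @cZ A'; case: (A' \in Z) => // -> .
Qed.

End CycleParity.

(** * Bridges and the parity of faces *)

Section PlaneParity.
Variables (V F : finType) (G : signed_graph V) (M : embedding G F).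
Hypothesis hplane : plane M.

(** If the two faces differ, the coboundary of one of them is an even set through uv, so u and v
    remain connected without uv. Conversely, a path around uv closes up to an even set; this is a
    coboundary, so uv has different faces on its sides. *)
Lemma bridge_face u v : adj G u v -> bridge G [set u; v] = (face M u v == face M v u).
Proof.
move=> a; have nuv := adj_neq a.
apply/idP/idP => [br|].
  apply: contraTT br => nf; set f := face M u v.
  have uvX : [set u; v] \in cobord M [set f].
    by rewrite cobordE // /parts !inE eqxx eq_sym (negPf nf).
  have := even_connect (cobord_sub M [set f]) (bd_cobord M [set f]) a uvX.
  move=> cuv; apply/negP => /forallP /(_ u); rewrite !inE eqxx /=.
  move=> /forallP /(_ v); rewrite !inE eqxx orbT (negPf nuv) implybF => /negP; apply.
  apply: connect_sub cuv => x y /= /andP [xyX nA]; apply: connect1.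
  rewrite /adj_del /= nA andbT /adj /=; exact: subsetP (cobord_sub M [set f]) _ xyX.
apply: contraTT; rewrite /bridge negb_forall => /existsP [x].
rewrite negb_imply negb_forall => /andP [xA /existsP [y]]; rewrite !negb_imply => /and3P [yA cxy nxy].
have jA : joins (@incident V) [set u; v] x y.
  suff -> : [set u; v] = [set x; y] by apply: joins_edge.
  apply/esym/eqP; rewrite eqEcard !cards2 nxy nuv andbT.
  by apply/subsetP => z; rewrite !inE => /orP [] /eqP ->; rewrite -in_set2.
have [|P PE bP] := @path_chain _ _ (@incident V) (edges G :\ [set u; v]) x y.
  apply: connect_sub cxy => w z /= /andP [wz nA]; apply: connect1.
  by apply/existsP; exists [set w; z]; rewrite in_setD1 nA joins_edge ?(adj_neq wz) ?andbT.
have [||X ZX] := cycle_cobord hplane (face M u v) (Z := symd [set [set u; v]] P).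
- apply: symd_sub; first by rewrite sub1set.
  by apply: subset_trans PE _; apply: subD1set.
- by move=> z; rewrite bd_symd bd1 bP (joinsP _ _ _ _ jA) addbb.
have : [set u; v] \in cobord M X.
  rewrite -ZX in_symd inE eqxx /=; apply/negP => /(subsetP PE).
  by rewrite !inE eqxx.
by rewrite cobordE // /parts; apply: contraTneq => ->; rewrite addbb.
Qed.

(** An edge with f on both sides is a bridge, counted twice, and vanishes modulo 2. *)
Lemma odd_face_parity f : odd_face M f = parity G (cobord M [set f]).
Proof.
rewrite /odd_face (big_morph odd oddD (erefl _)) big_mkcond [RHS]big_mkcond.
apply: eq_bigr => A _; rewrite in_setI; have [Ao|_] := boolP (A \in odd_edges G); last first.
  by rewrite andbF.
have [u [v [AE a]]] := edge_ends (odd_edge Ao).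
rewrite andbT AE [RHS](cobordE _ _ a).
rewrite (bridge_face a) /parts !inE.
have -> : [exists x, exists y, ([set u; v] == [set x; y]) && (face M x y == f)]
    = (face M u v == f) || (face M v u == f).
  apply/existsP/orP => [[x /existsP [y /andP [/eqP /set2_eq + ff]]]|[] ff].
  - by case=> -[-> ->]; [left|right].
  - by exists u; apply/existsP; exists v; rewrite eqxx.
  - by exists v; apply/existsP; exists u; rewrite setUC eqxx.
rewrite [[set u; v] \in edges G]a /=.
case: (eqVneq (face M u v) f) => [<-|nf] /=.
  by rewrite eq_sym; case: (face M v u == face M u v).
by case: (eqVneq (face M v u) f) => [->|_] //; rewrite (negPf nf).
Qed.

Lemma parity_cobord (X : {set F}) :
  parity G (cobord M X) = \big[addb/false]_(f in X) odd_face M f.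
Proof.
under [RHS]eq_bigr do rewrite odd_face_parity.
rewrite exchange_big; apply: eq_bigr => A /odd_edge AE.
have [u [v [-> a]]] := edge_ends AE; rewrite cobordE // /parts.
under [RHS]eq_bigr do rewrite cobordE // /parts !in_set1.
rewrite big_split /=; under eq_bigr do rewrite eq_sym.
by rewrite big_addb_eq1; under eq_bigr do rewrite eq_sym; rewrite big_addb_eq1.
Qed.

End PlaneParity.

(** * The face-vertex graph *)

Section FaceVertex.
Variables (V F : finType) (G : signed_graph V) (M : embedding G F).
Hypothesis hplane : plane M.

Definition corner (e : V * F) (x : V + F) : bool :=
  (x == inr e.2) (+) (x == inl e.1).

Definition corners : {set V * F} := [set e | e.1 \in boundary M e.2].

Lemma in_corners v f : ((v, f) \in corners) = (v \in boundary M f).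
Proof. by rewrite [LHS]inE. Qed.

Definition is_face (x : V + F) : bool := if x is inr _ then true else false.

Definition face_pred (P : pred F) (x : V + F) : bool := if x is inr f then P f else false.

Local Notation oddF := (face_pred (odd_face M)).

Lemma corner_joins v f : joins corner (v, f) (inr f) (inl v).
Proof. by apply/joinsP. Qed.

Lemma corner_link v f : v \in boundary M f -> link corner corners (inr f) (inl v).
Proof.
by move=> vf; apply/existsP; exists (v, f); rewrite in_corners vf corner_joins.
Qed.

Lemma corners_connected (x : V + F) f : connect (link corner corners) x (inr f).
Proof.
have cF g h : connect (link corner corners) (inr g) (inr h).
  have [hc _] := hplane; have /connectP [p] := hc g h; clear hc.
  elim: p g => [|k p IH] g /=; first by move=> _ ->; apply: connect0.
  case/andP=> /pred0Pn [v /= /andP [vg vk]] /IH h1 /h1; apply: connect_trans.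
  apply: connect_trans (connect1 (corner_link vg)) _.
  by rewrite link_csym; apply: connect1 (corner_link vk).
case: x => [v|g]; last exact: cF.
have [g vg] : exists g, v \in boundary M g.
  have [iv|] := boolP (isolated G v).
    by exists (iface M v); rewrite inE iv eqxx orbT.
  by rewrite negb_forall => /existsP [w /negbNE a]; exists (face M v w); apply: boundary_face.
apply: connect_trans (cF g f).
by rewrite link_csym; apply: connect1 (corner_link vg).
Qed.

Lemma sum_face_pred (P Q : pred F) (R : pred (V + F)) :
  (forall f, R (inr f) = P f) ->
  \big[addb/false]_(x | R x) face_pred Q x = \big[addb/false]_(f | P f) Q f.
Proof.
move=> RP; rewrite big_sumType /= big1 // addFb; exact: eq_bigl.
Qed.

(** The coboundary of the set of all faces is empty. *)
Lemma odd_faces_even : \big[addb/false]_x oddF x = false.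
Proof.
rewrite (@sum_face_pred predT) // (eq_bigl (mem [set: F])); last by move=> f; rewrite !inE.
rewrite -(parity_cobord hplane) /parity big1 // => A /odd_edge /edge_ends [u [v [-> a]]].
by rewrite cobordE // /parts !inE.
Qed.

(** An odd cycle avoiding the set is the coboundary of some X containing oddly many odd faces. A
    vertex used by J is off the cycle, so its faces are all in X or all outside. *)
Lemma join_transversal (J : {set V * F}) (f0 : F) : J \subset corners ->
  (forall x, bd corner J x = oddF x) ->
  odd_transversal G [set v | [exists f, (v, f) \in J]].
Proof.
move=> JL bJ [c /andP [oc /disjointFr cS]]; have /andP [cc co] := oc.
have [X ZX] := cycle_cobord hplane f0 (cycle_edges_sub cc) (fun v => bd_cycle_edges v cc).
have pX : \big[addb/false]_(f in X) odd_face M f.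
  by rewrite -(parity_cobord hplane) -ZX parity_cycle_edges.
(* No edge of J crosses Y, so the boundary of J is even on Y, against the odd count of odd faces in
   X. *)
pose Y (x : V + F) :=
  match x with inr f => f \in X | inl v => [exists f in X, v \in boundary M f] end.
have := bd_cut corner J Y.
rewrite (eq_bigr _ (fun x _ => bJ x)) (@sum_face_pred (mem X)) // pX.
rewrite big1 // => -[v f] eJ; rewrite (joins_cut _ (corner_joins v f)) /=.
have vf : v \in boundary M f by have := subsetP JL _ eJ; rewrite inE.
have vc : v \notin c.
  by apply/negP => /cS; rewrite inE => /existsP; apply; exists f.
have nv A : A \in cobord M X -> v \notin A.
  rewrite -ZX => /cycle_edgesP [x xc ->]; apply: contra vc; rewrite !inE.
  by case/orP => /eqP ->; rewrite ?mem_next.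
suff -> : [exists g in X, v \in boundary M g] = (f \in X) by rewrite addbb.
apply/existsP/idP => [[g /andP [gX vg]]|fX]; last by exists f; rewrite fX.
by rewrite (face_agree nv vf vg).
Qed.

(** A vertex used by J has positive even degree in J, hence degree at least 2. *)
Lemma join_card (J : {set V * F}) : (forall v, bd corner J (inl v) = false) ->
  2 * #|[set v | [exists f, (v, f) \in J]]| <= #|J|.
Proof.
move=> bJ; rewrite -[leqRHS]sum1_card (partition_big fst predT) //= mulnC -sum_nat_const.
rewrite [leqRHS](bigID (mem [set v | [exists f, (v, f) \in J]])) /=.
apply: leq_trans (leq_addr _ _); apply: leq_sum => v; rewrite inE => /existsP [f vf].
have := bJ v; rewrite /bd /corner.
rewrite (eq_bigr (fun e => e.1 == v)); last by move=> e _; rewrite /= eq_sym.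
rewrite big_addb_odd sum1_card.
have -> : #|[pred e in J | e.1 == v]| = #|[pred i | (i \in J) && (i.1 == v)]| by [].
set m := #|_| => om; have : 0 < m by apply/card_gt0P; exists (v, f); rewrite inE /= vf eqxx.
by case: m om => [|[|m]].
Qed.

Variable dead : {set F}.

(** The coboundary of the faces in the second component is odd, so it contains an odd cycle. Each
    vertex of that cycle bounds faces both in and out of that component, which forces it into the
    first one. *)
Lemma odd_cut_cycle p :
  odd_cut corner corners is_face oddF (face_pred (mem dead)) p ->
  exists c, [/\ odd_cycle G c, dead_free M dead c & forall x, x \in c -> inl x \in p.1].
Proof.
case=> h1 h2 h3 h4; pose X := [set f : F | inr f \in p.2].
have pX : parity G (cobord M X).
  rewrite (parity_cobord hplane) -(@sum_face_pred (mem X) _ (mem p.2)) //.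
  by move=> f; rewrite !inE.
have [c oc cX] := odd_cycle_exists (cobord_sub M X) (bd_cobord M X) pX.
have inU x w : adj G x w -> parts M X x w -> inl x \in p.1.
  move=> a.
  have two f g : x \in boundary M f -> x \in boundary M g -> f \in X -> g \notin X ->
      inl x \in p.1.
    move=> xf xg; rewrite ![_ \in X]inE => fX gX.
    have := h3 (x, f) _ _ _ (corner_joins x f) fX; rewrite in_corners xf => /(_ isT).
    rewrite inE => /orP [] // xp; have := corner_joins x g; rewrite joinsC => jg.
    have := h3 (x, g) _ _ _ jg xp; rewrite in_corners xg inE (negPf gX) => /(_ isT) /=.
    by move=> /h1.
  rewrite /parts; have fb := boundary_face M a; have rb := boundary_face_rev M a.
  case f1: (_ \in X); case f2: (_ \in X) => // _.
    by apply: two fb rb f1 _; rewrite f2.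
  by apply: two rb fb f2 _; rewrite f1.
have cU x : x \in c -> inl x \in p.1.
  move=> /cX [A AX xA]; have [u [v [AE a]]] := edge_ends (subsetP (cobord_sub M X) _ AX).
  move: AX xA; rewrite AE cobordE // !inE => pt /orP [] /eqP ->; first exact: inU pt.
  by apply: (@inU v u); rewrite 1?adj_sym // partsC.
exists c; split=> // f fd; apply/pred0P => x; apply/negP => /= /andP [/cU xU xf].
have jx := corner_joins x f; rewrite joinsC in jx.
by have := h2 (x, f) _ _ _ jx xU; rewrite in_corners xf /= fd => /(_ isT).
Qed.

End FaceVertex.

(** * The two extremal numbers and the final count *)

Lemma tau_le (V : finType) (G : signed_graph V) (S : {set V}) :
  odd_transversal G S -> tau G <= #|S|.
Proof.
move=> tS; rewrite /tau; case: arg_minnP => [|S' _]; last by apply; apply/asboolP.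
(* The default set of the minimum, all of V, is a transversal because cycles are nonempty. *)
apply/asboolP => -[[|x c]]; rewrite /odd_cycle /is_cycle //= => /andP [_].
by move=> /pred0P /(_ x); rewrite /= !inE eqxx.
Qed.

(** One vertex chosen on each cycle gives k distinct vertices, so k is in the range of the
    maximum. *)
Lemma nu_dead_ge (V F : finType) (G : signed_graph V) (M : embedding G F)
    (dead : {set F}) k (c : 'I_k -> seq V) :
  dead_packing M dead c -> k <= nu_dead M dead.
Proof.
move=> pc; have [oc dc] := pc.
have kV : k <= #|V|.
  have /fin_all_exists [g gc] : forall i, exists v, v \in c i.
    move=> i; have [/andP [/andP [+ _] _] _] := oc i.
    by case: (c i) => // x s _; exists x; rewrite inE eqxx.
  rewrite -(card_ord k) -(card_imset predT (f := g)) ?max_card // => i j gij.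
  apply/eqP; apply: contraT => /dc /pred0P /(_ (g i)).
  by rewrite /= gc gij gc.
rewrite /nu_dead (bigmax_sup (Ordinal (kV : k < #|V|.+1))) //.
by apply/asboolP; exists c.
Qed.

Theorem theorem7 (V F : finType) (G : signed_graph V) (M : embedding G F)
    (dead : {set F}) (hplane : plane M)
    (hodd : exists f : F, odd_face M f)
    (hdead : forall f : F, odd_face M f -> f \in dead) :
  tau G <= nu_dead M dead + 2 * #|dead| - 2.
Proof.
have [f0 of0] := hodd.
pose oddF := face_pred (V := V) (odd_face M).
pose deadF := face_pred (V := V) (mem dead).
have [||||||J [ps [JL bJ cuts disj leJ]]] := @join_cut_packing _ _ #|[set: V + F]|
    (@corner V F) (corners M) (@is_face V F) oddF deadF [set: V + F] (inr f0).
- by [].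
- move=> -[v f] _; exists (inr f), (inl v); rewrite !inE; split=> //; split=> //.
  exact: corner_joins.
- by move=> x; rewrite inE.
- by rewrite inE.
- by move=> x _; apply: corners_connected.
- exact: odd_faces_even.
apply: leq_trans (tau_le (join_transversal hplane f0 JL bJ)) _.
have cJ : 2 * #|[set v | [exists f, (v, f) \in J]]| <= #|J|.
  by apply: join_card => v; rewrite bJ.
(* Vertices start with potential 0, and so do non-deadly faces, which are even; each deadly face
   other than the root has 4. *)
have potE : \sum_(x in [set: V + F] | x != inr f0) potential (@is_face V F) oddF deadF x
    = 4 * #|dead :\ f0|.
  rewrite big_sumType /= big1 // add0n mulnC -sum_nat_const.
  rewrite big_mkcond [RHS]big_mkcond; apply: eq_bigr => f _.
  rewrite !inE /= (_ : (inr f != inr f0 :> V + F) = (f != f0)) //.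
  case: eqP => //= _; rewrite /potential /pot /=; case: ifP => // nd.
  by rewrite (negbTE (contraFN (@hdead f) nd)).
rewrite potE in leJ.
have kn : size ps <= nu_dead M dead.
  have /fin_all_exists [c cP] : forall i : 'I_(size ps), exists c,
      [/\ odd_cycle G c, dead_free M dead c
        & forall x, x \in c -> inl x \in (nth (set0, set0) ps i).1].
    by move=> i; apply: (odd_cut_cycle hplane); apply: cuts; apply: mem_nth.
  apply: (@nu_dead_ge _ _ _ _ _ _ c); split=> [i|]; first by have [] := cP i.
  have dlt (i j : 'I_(size ps)) : i < j -> [disjoint c i & c j].
    move=> ij; have /pairwiseP := disj => /(_ (set0, set0) i j).
    rewrite !inE !ltn_ord => /(_ isT isT ij) /pred0P h.
    apply/pred0P => x; apply/negP => /= /andP [xi xj].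
    have [_ _ /(_ _ xi) xi'] := cP i; have [_ _ /(_ _ xj) xj'] := cP j.
    by have := h (inl x); rewrite /= xi' xj'.
  move=> i j; rewrite neq_ltn => /orP [/dlt //|/dlt]; by rewrite disjoint_sym.
have dE : #|dead| = #|dead :\ f0|.+1 by rewrite (cardsD1 f0) hdead.
(* Twice the size of the transversal is at most 2 k + 4 (d - 1), with k the size of the packing. *)
move: (leq_trans cJ leJ) kn; rewrite dE.
by move: #|[set v | _]| (size ps) (nu_dead M dead) #|dead :\ f0| => s k n d; lia.
Qed.
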